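(* For any $i,j \in \mathbb{N}$ we have \[ C(i,j,0) = \frac{1}{2} i^{j-1} j^{i-1} \sum_{r=2}^{\min\{i,j\}} \frac{(i)_r(j)_r}{i^r j^r}\left(i + j-r\right), \] and so in particular, for any $i=i(n),j=j(n) \in \mathbb{N}$ satisfying $i,j \rightarrow \infty$ and $\frac{1}{2}\leq \frac{i}{j}\leq 2$ we have \[ C(i,j,0)\approx \sqrt{\frac{\pi}{8}} \sqrt{i+j}\, i^{j-\frac{1}{2}} j^{i-\frac{1}{2}}. \]
   Context: $\mathbb{N}$ is the set of positive integers. For $i,j\in\mathbb{N}$ and $\ell\in\mathbb{Z}$, $C(i,j,\ell)$ denotes the number of connected bipartite graphs on labelled vertices with $i$ vertices in one (given) partition class, $j$ vertices in the second (given) partition class, and $i+j+\ell$ edges. $(m)_r:=\prod_{s=0}^{r-1}(m-s)$ is the falling factorial. $f(n)\approx g(n)$ means $f=(1+o(1))g$ as $n\to\infty$. *)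

(* Defs.v *)
From mathcomp Require Import all_boot all_order all_algebra.

Set Implicit Arguments.
Unset Strict Implicit.
Unset Printing Implicit Defensive.

Import GRing.Theory.

(* A bipartite graph with labelled classes 'I_i and 'I_j is given by its edge
   set E : {set 'I_i * 'I_j}; the vertex type is the disjoint sum 'I_i + 'I_j. *)
Definition bip_adj (i j : nat) (E : {set 'I_i * 'I_j}) : rel ('I_i + 'I_j) :=
  fun u v =>
    match u, v with
    | inl a, inr b => (a, b) \in E
    | inr b, inl a => (a, b) \in E
    | _, _ => false
    end.

Definition bip_connected (i j : nat) (E : {set 'I_i * 'I_j}) : bool :=
  [forall u, forall v, connect (bip_adj E) u v].

Definition bip_count (i j : nat) (l : int) : nat :=
  #|[set E : {set 'I_i * 'I_j} |
      bip_connected E && (#|E|%:Z == i%:Z + j%:Z + l)%R]|.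

(* Main.v *)
(**
  A connected bipartite graph with as many edges as vertices has exactly two
  orientations as the graph of a function [f] on its vertices: each vertex off
  the cycle points towards it, and the cycle is run through in one of its two
  directions. Hence [2 * C(i, j, 0)] counts the side-swapping self-maps of
  ['I_i + 'I_j] with a single cycle, of length at least 4. If the values of [f]
  are drawn uniformly, a vertex set with [n] and [m] vertices on the two sides
  contains no cycle of [f] with probability [1 - n m / (i j)]; applied to the
  complement of a prescribed cycle of length [2 r], this gives the summand of
  index [r].

  For the asymptotics put [h ^ 2 = (1 / i + 1 / j) / 2]. The product
  [(i)_r (j)_r / (i ^ r j ^ r)] is at most [exp (- ((r - 1) h) ^ 2)], and for
  [r <= e * min i j] at least [exp (- (r h) ^ 2 / (1 - e))], so the sum is
  squeezed between two Riemann sums of the Gauss integral.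
*)
Require Import Defs.
From mathcomp Require Import all_boot all_order all_algebra.
From mathcomp Require Import zify ring lra.

Set Implicit Arguments.
Unset Strict Implicit.
Unset Printing Implicit Defensive.

Import Order.TTheory GRing.Theory Num.Theory.

(** * Orientations of unicyclic graphs *)

Definition orient (V : finType) (f : V -> V) : rel V :=
  fun u v => (f u == v) || (f v == u).

Lemma orient_sym (V : finType) (f : V -> V) : symmetric (orient f).
Proof. by move=> u v; rewrite /orient orbC. Qed.

(** Inclusion-exclusion: the arcs [(u, f u)] and their reversals number [#|V|] each, and the overlap
    corresponds to the [u] with [f (f u) = u]. If there are none, [orient f] has exactly [#|V|]
    edges. *)
Lemma card_orient (V : finType) (f : V -> V) :
  (#|[set a : V * V | orient f a.1 a.2]| + #|[set u | f (f u) == u]|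
    = 2 * #|V|)%N.
Proof.
pose A := [set (u, f u) | u in V]; pose B := [set (f u, u) | u in V].
have -> : [set a : V * V | orient f a.1 a.2] = A :|: B.
  apply/setP=> -[u v]; rewrite !inE /orient /=; congr (_ || _).
    by apply/eqP/imsetP => [<-|[w _ [-> ->]]//]; exists u.
  by apply/eqP/imsetP => [<-|[w _ [-> ->]]//]; exists v.
have -> : #|[set u | f (f u) == u]| = #|A :&: B|.
  rewrite -(card_imset (f := fun u => (u, f u)) [set u | f (f u) == u]);
    last by move=> u v [].
  congr #|pred_of_set _|; apply/setP=> -[u v]; rewrite !inE.
  apply/imsetP/andP => [[w]|[/imsetP[w _ [-> ->]] /imsetP[w' _ [ww fw]]]].
    rewrite inE => /eqP fw [-> ->]; split; apply/imsetP; first by exists w.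
    by exists (f w); rewrite ?fw.
  by exists w; rewrite // inE fw -ww.
rewrite cardsUI !card_imset ?mul2n ?addnn //; by move=> u v [].
Qed.

(** Breadth-first search: [d] is the distance to [a], and [p] picks a neighbour nearer to it. *)
Lemma connected_parent (V : finType) (e : rel V) (a : V) :
    (forall v, connect e v a) ->
  exists (p : V -> V) (d : V -> nat),
    forall v, v != a -> e v (p v) /\ (d (p v) < d v)%N.
Proof.
move=> cea.
pose P v n := [exists t : n.-tuple V, path e v t && (last v t == a)].
have exP v : exists n, P v n.
  have /connectP[t pt lt] := cea v.
  by exists (size t); apply/existsP; exists (in_tuple t); rewrite pt -lt eqxx.
pose d v := ex_minn (exP v).
have step v : v != a -> exists w, e v w && (d w < d v)%N.
  move=> va; rewrite [d v]/d; case: ex_minnP => n /existsP[t /andP[pt lt]] _.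
  case: n t pt lt => [|n] t; first by rewrite (tuple0 t) /= (negPf va).
  case/tupleP: t => w t /= /andP[evw pt] lt; exists w; rewrite evw ltnS /d.
  case: ex_minnP => m _; apply; apply/existsP; exists t.
  by rewrite pt lt.
(* The default [v] is only met at [a], where nothing is nearer. *)
exists (fun v => odflt v [pick w | e v w && (d w < d v)%N]), d => v va.
case: pickP => [w /andP[]//|no]; have [w] := step v va.
by rewrite no.
Qed.


(** Iteration from [u0] runs into a cycle. Any [x] on it will do, since the set of vertices flowing
    to [x] is closed under [orient f] in both directions. *)
Lemma functional_root (V : finType) (f : V -> V) (u0 : V) :
  (forall v, connect (orient f) u0 v) -> exists x, forall v, fconnect f v x.
Proof.
move=> cf; have /trajectP[m mk fm] := looping_order f u0.
have xx : fconnect f (f (iter m f u0)) (iter m f u0).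
  apply/connectP; exists (traject f (f (f (iter m f u0))) (order f u0 - m.+1)).
    exact: fpath_traject.
  by rewrite last_traject -iterSr -iterD -{1}fm; congr iter; lia.
exists (iter m f u0) => v.
pose S := [pred v | fconnect f v (iter m f u0)].
have cl : closed (orient f) S.
  apply: intro_closed; first exact/sym_connect_sym/orient_sym.
  move=> u w /orP[/eqP <-|/eqP fw] /=; rewrite !inE.
    rewrite fconnect_eqVf => /orP[/eqP ->|//]; exact: xx.
  by rewrite -fw => ?; apply: connect_trans (fconnect1 f w) _.
have := closed_connect cl (cf v); rewrite !inE fconnect_iter => /esym.
exact.
Qed.

(** As everything flows to [x], the set [fconnect f x] is the cycle through [x], and going once
    around it from [f v] finds the predecessor of [v]. *)
Lemma fconnect_pred (V : finType) (f : V -> V) (x v : V) :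
    (forall w, fconnect f w x) -> fconnect f x v ->
  exists2 u, fconnect f x u & f u = v.
Proof.
move=> fx xv; have fvv : fconnect f (f v) v := connect_trans (fx _) xv.
exists (iter (findex f (f v) v) f v); last by rewrite -iterS iterSr iter_findex.
exact: connect_trans xv (fconnect_iter f _ _).
Qed.

(** A spanning tree has [#|V| - 1] edges, so some edge [(b, c)] lies outside it, and the tree still
    connects everything once this edge is deleted. *)
Lemma connected_nonbridge (V : finType) (e : rel V) (a : V) :
    symmetric e -> irreflexive e -> (forall u v, connect e u v) ->
    #|[set p : V * V | e p.1 p.2]| = (2 * #|V|)%N ->
  exists b c, e b c /\ forall u v, connect
    (fun u v => [&& e u v, (u, v) != (b, c) & (u, v) != (c, b)]) u v.
Proof.
move=> se ie ce ae; have [p [d pd]] := connected_parent (fun v => ce v a).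
pose A := [set (v, p v) | v in [set~ a]] :|: [set (p v, v) | v in [set~ a]].
have cA : (#|A| < 2 * #|V|)%N.
  have V0 : (0 < #|V|)%N by apply/card_gt0P; exists a.
  have := (leq_card_setU [set (v, p v) | v in [set~ a]] [set (p v, v) | v in [set~ a]]).1.
  rewrite !card_imset ?cardsC1 => [|u v [] //|u v [] //]; rewrite -/A; lia.
have /subsetPn[[b c]] : ~~ ([set p : V * V | e p.1 p.2] \subset A).
  by apply: contraL cA => /subset_leq_card; rewrite -leqNgt ae.
rewrite !inE /= negb_or => ebc /andP[bc cb]; exists b, c; split=> //.
set e' := (X in connect X).
have se' : symmetric e'.
  by move=> u v; rewrite /e' se; congr (_ && _); rewrite andbC; congr (_ && _);
    rewrite !xpair_eqE andbC.
have ca u : connect e' u a.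
  have [n] := ubnP (d u); elim: n u => // n IH u du.
  have [->//|ua] := eqVneq u a; have [eu pu] := pd _ ua.
  apply: connect_trans (IH (p u) _); last by lia.
  apply: connect1; rewrite /e' eu /=; apply/andP; split.
    by apply: contraNneq bc => <-; apply/imsetP; exists u; rewrite ?inE.
  by apply: contraNneq cb => -[<- <-]; apply/imsetP; exists u; rewrite ?inE.
move=> u v; apply: connect_trans (ca u) _.
by rewrite (sym_connect_sym se').
Qed.

(** In a spanning tree of the graph without the edge [(b, c)], let each vertex point to its parent
    towards the root [b], and let [b] point to [c]. These arcs lie in [e] and exhaust it by
    counting. *)
Lemma orientation_exists (V : finType) (e : rel V) (b c : V) :
    symmetric e -> irreflexive e -> e b c ->
    #|[set p : V * V | e p.1 p.2]| = (2 * #|V|)%N ->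
    (forall u v, connect
      (fun u v => [&& e u v, (u, v) != (b, c) & (u, v) != (c, b)]) u v) ->
  exists f : V -> V, f b = c /\ e =2 orient f.
Proof.
move=> se ie ebc ae; set e' := (X in connect X) => ce.
have [p [d pd]] := connected_parent (fun v => ce v b).
pose f v := if v == b then c else p v; exists f.
have fb : f b = c by rewrite /f eqxx.
have fe v : e v (f v).
  rewrite /f; case: eqVneq => [->//|vb]; by have [/and3P[]] := pd _ vb.
split=> //.
have bc : c != b by apply: contraTneq ebc => ->; rewrite ie.
(* Two parent steps would both decrease [d], and a 2-cycle through [b] would use the deleted edge as
   a parent step. *)
have f2 : [set u | f (f u) == u] = set0.
  apply/setP=> u; rewrite !inE; apply/negP => /eqP; rewrite {2}/f.
  case: (eqVneq u b) => [->|ub].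
    rewrite /f (negPf bc) => pc; have [/and3P[_ _]] := pd _ bc.
    by rewrite pc eqxx.
  rewrite /f; case: (eqVneq (p u) b) => [pub cu|pub pu].
    by have [/and3P[_ _]] := pd _ ub; rewrite pub -cu eqxx.
  have [_] := pd _ ub; have [_] := pd _ pub; rewrite pu; lia.
have := card_orient f; rewrite f2 cards0 addn0 => cf.
have /eqP/setP E : [set a : V * V | orient f a.1 a.2] == [set p : V * V | e p.1 p.2].
  rewrite eqEcard ae cf leqnn andbT; apply/subsetP=> -[u v]; rewrite !inE /=.
  by case/orP=> /eqP <- //; rewrite se.
by move=> u v; have := E (u, v); rewrite !inE.
Qed.

(** An orientation [k] that differs from [f] at [w] must reverse the edge from [w] to [f w], and
    this propagates along [f] to the whole cycle. Off the cycle no edge can be reversed, so [k] is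
    [f] with its cycle reversed, and there is only one such map. *)
Lemma orientation_third (V : finType) (f g h : V -> V) (x v : V) :
    (forall w, fconnect f w x) -> (forall w, f (f w) != w) ->
    orient f =2 orient g -> orient f =2 orient h ->
    (exists w, f w != g w) -> (exists w, f w != h w) ->
  g v = h v.
Proof.
move=> fx f2; pose C := fconnect f x.
have main (k : V -> V) : orient f =2 orient k -> (exists w, f w != k w) ->
    (forall w, C w -> k (f w) = w) /\ (forall w, ~~ C w -> k w = f w).
  move=> fk [w0 w0D]; pose D := [pred w | f w != k w].
  have kf w : w \in D -> k (f w) = w.
    rewrite inE => fkw; have := fk w (f w); rewrite /orient eqxx /=.
    by rewrite [k w == _]eq_sym (negPf fkw) => /esym/eqP.
  have Df w : w \in D -> f w \in D.
    by move=> wD; rewrite inE (kf _ wD) f2.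
  have Dc w u : w \in D -> fconnect f w u -> u \in D.
    by move=> wD /iter_findex <-; elim: (findex _ _ _) => //= n; exact: Df.
  have xD : x \in D by apply: Dc (fx w0); rewrite inE.
  have CD w : C w -> w \in D by exact: Dc.
  split=> [w /CD/kf//|w]; apply: contraNeq; rewrite eq_sym => wD.
  (* Backwards from the cycle: if [f y] is on it, with cycle predecessor [u], then [k (f y)] is both
     [y] and [u], so [y] is on the cycle too. *)
  have : C (iter (findex f w x) f w) by rewrite iter_findex /C.
  elim: (findex f w x) => // n IH /=; set y := iter n f w => Cfy; apply: IH.
  have yD : y \in D by apply: Dc (fconnect_iter _ _ _).
  have [u Cu fu] := fconnect_pred fx Cfy.
  by rewrite -/y -(kf _ yD) -fu kf ?CD.
move=> fg fh fgN fhN; have [g1 g2] := main g fg fgN; have [h1 h2] := main h fh fhN.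
have [Cv|Cv] := boolP (C v); last by rewrite g2 ?h2.
by have [u Cu <-] := fconnect_pred fx Cv; rewrite g1 ?h1.
Qed.

(** A non-bridge [(b, c)] can be oriented either way. The two resulting maps differ at [b], and
    [orientation_third] excludes any other. *)
Lemma card_orientations (V : finType) (e : rel V) (a : V) :
    symmetric e -> irreflexive e -> (forall u v, connect e u v) ->
    #|[set p : V * V | e p.1 p.2]| = (2 * #|V|)%N ->
  #|[set f : {ffun V -> V} | [forall u, forall v, e u v == orient f u v]]| = 2%N.
Proof.
move=> se ie ce ae; have [b [c [ebc cbc]]] := connected_nonbridge a se ie ce ae.
have [f [fb ef]] := orientation_exists se ie ebc ae cbc.
have ecb : e c b by rewrite se.
have [u v|g [gc eg]] := orientation_exists se ie ecb ae.
  by rewrite (eq_connect (e' := _) (fun u v => congr1 _ (andbC _ _))).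
have two k : e =2 orient k -> forall w, k (k w) != w.
  move=> ek w; have := card_orient k.
  have -> : [set p : V * V | orient k p.1 p.2] = [set p : V * V | e p.1 p.2].
    by apply/setP=> p; rewrite !inE ek.
  rewrite ae => /eqP; rewrite -{2}(addn0 (2 * _)%N) eqn_add2l cards_eq0.
  by move/eqP/setP/(_ w); rewrite !inE => ->.
have [|x fx] := @functional_root V f a; first by move=> v; rewrite -(eq_connect ef).
have fg : f b != g b by rewrite fb; apply: contraNneq (two g eg c) => cg; rewrite gc -cg.
have -> : [set f : {ffun V -> V} | [forall u, forall v, e u v == orient f u v]]
   = [set finfun f; finfun g].
  apply/setP=> h; rewrite !inE; apply/forallP/orP => [eh|].
    have {}eh : e =2 orient h by move=> u v; apply/eqP; have /forallP := eh u.
    have [->|/eqP fh] := eqVneq h (finfun f); [by left | right].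
    apply/eqP/ffunP=> v; rewrite ffunE; apply/esym.
    apply: (orientation_third v fx (two f ef)).
    - by move=> u w; rewrite -ef eg.
    - by move=> u w; rewrite -ef eh.
    - by exists b.
    - apply/existsP; apply: contra_notT fh => /existsPn fh.
      by apply/ffunP=> w; rewrite ffunE; have /negPn/eqP -> := fh w.
  have oE k : orient (finfun k : {ffun V -> V}) =2 orient k.
    by move=> u v; rewrite /orient !ffunE.
  by case=> /eqP-> u; apply/forallP=> v; rewrite oE ?ef ?eg //; apply/eqP; rewrite -?ef -?eg.
by rewrite cards2; case: eqP => // /ffunP/(_ b); rewrite !ffunE => /eqP; rewrite (negPf fg).
Qed.

(** A vertex reached from everywhere lies on a cycle and makes it the only one. The middle clause
    excludes cycles of length 2, whose two arcs give the same edge. *)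
Definition unicyclic (V : finType) (s : V -> bool) (f : V -> V) :=
  [&& [forall v, s (f v) != s v], [forall v, f (f v) != v]
    & [exists x, forall v, fconnect f v x]].

(** * From connected bipartite graphs to unicyclic maps *)

Definition left_side (i j : nat) (v : 'I_i + 'I_j) : bool :=
  if v is inl _ then true else false.

Lemma bip_adj_sym (i j : nat) (E : {set 'I_i * 'I_j}) : symmetric (bip_adj E).
Proof. by case=> [x|x] [y|y]. Qed.

Lemma bip_adj_irr (i j : nat) (E : {set 'I_i * 'I_j}) : irreflexive (bip_adj E).
Proof. by case. Qed.

Lemma card_bip_adj (i j : nat) (E : {set 'I_i * 'I_j}) :
  #|[set p | bip_adj E p.1 p.2]| = (2 * #|E|)%N.
Proof.
pose A := [set (inl e.1 : 'I_i + 'I_j, inr e.2 : 'I_i + 'I_j) | e in E].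
pose B := [set (inr e.2 : 'I_i + 'I_j, inl e.1 : 'I_i + 'I_j) | e in E].
have -> : [set p | bip_adj E p.1 p.2] = A :|: B.
  apply/setP=> -[[x|x] [y|y]]; rewrite !inE /=; apply/esym.
  - by apply/orP; case=> /imsetP[].
  - apply/orP/idP => [[] /imsetP[[a b] //= ? [-> ->]]//|xy].
    by left; apply/imsetP; exists (x, y).
  - apply/orP/idP => [[] /imsetP[[a b] //= ? [-> ->]]//|xy].
    by right; apply/imsetP; exists (y, x).
  - by apply/orP; case=> /imsetP[].
have := cardsUI A B; have -> : A :&: B = set0.
  apply/setP=> p; rewrite !inE; apply/andP=> -[/imsetP[? _ ->] /imsetP[? _]].
  by case.
rewrite cards0 addn0 => ->; rewrite mul2n -addnn.
by rewrite !card_imset // => -[? ?] [? ?] [-> ->].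
Qed.

(** The maps are sorted by their underlying edge set; the fibre over a connected graph with [i + j]
    edges consists of its two orientations. *)
Lemma bip_count_unicyclic (i j : nat) : (0 < i)%N ->
  (2 * bip_count i j 0)%N =
    #|[set f : {ffun 'I_i + 'I_j -> 'I_i + 'I_j} | unicyclic (@left_side i j) f]|.
Proof.
move=> i0; pose V : finType := ('I_i + 'I_j)%type.
have cV : #|V| = (i + j)%N by rewrite card_sum !card_ord.
pose gr (f : V -> V) : {set 'I_i * 'I_j} := [set e | orient f (inl e.1) (inr e.2)].
have grE (f : V -> V) : [forall v, left_side (f v) != left_side v] ->
    bip_adj (gr f) =2 orient f.
  move/forallP=> sf.
  have sfN u v : left_side u = left_side v -> orient f u v = false.
    move=> uv; apply/norP; split; first by have := sf u; apply: contraNneq => ->; rewrite uv.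
    by have := sf v; apply: contraNneq => ->; rewrite uv.
  move=> [x|x] [y|y] /=.
  - by rewrite sfN.
  - by rewrite inE.
  - by rewrite inE orient_sym.
  - by rewrite sfN.
rewrite /bip_count; set W := [set E | _].
rewrite -[RHS]sum1_card (partition_big (fun f : {ffun V -> V} => gr f) (mem W)) /=.
  rewrite -[#|W|]sum1_card big_distrr /=; apply: eq_bigr => E EW.
  move: EW; rewrite inE => /andP[/forallP cE /eqP/= cE'].
  have {}cE u v : connect (bip_adj E) u v by have /forallP := cE u.
  have cardE : #|E| = (i + j)%N by move: cE'; rewrite GRing.addr0 => -[].
  rewrite muln1 sum1_card.
  rewrite -(card_orientations (inl (Ordinal i0)) (bip_adj_sym E) (bip_adj_irr E) cE);
    last by rewrite card_bip_adj cardE cV.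
  apply: eq_card => f; rewrite inE unfold_in /= in_set; apply/forallP/andP.
    move=> Ef; have {}Ef : bip_adj E =2 orient f.
      by move=> u v; apply/eqP; have /forallP := Ef u.
    have sf : [forall v, left_side (f v) != left_side v].
      apply/forallP=> v; have := Ef v (f v); rewrite /orient eqxx /=.
      by case: v (f v) => [x|x] [y|y].
    split; last first.
      by apply/eqP/setP=> -[x y]; rewrite inE /= -Ef.

    apply/and3P; split=> //; last first.
      have [|x fx] := @functional_root V f (inl (Ordinal i0)).
        by move=> v; rewrite -(eq_connect Ef).
      by apply/existsP; exists x; apply/forallP.
    have := card_orient f; rewrite cV.
    have -> : [set p : V * V | orient f p.1 p.2] = [set p | bip_adj E p.1 p.2].
      by apply/setP=> p; rewrite !inE Ef.
    rewrite card_bip_adj cardE -[X in _ = X]addn0 => /addnI /eqP.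
    rewrite cards_eq0 => /eqP/setP f2; apply/forallP=> v.
    by have := f2 v; rewrite !inE => ->.
  move=> [/and3P[sf _ _] /eqP <-] u; apply/forallP=> v.
  by rewrite grE.
(* Conversely, the graph of a unicyclic map is connected through [x], and the absence of 2-cycles
   gives it [i + j] edges. *)
move=> f; rewrite inE => /and3P[sf /forallP f2 /existsP[x /forallP fx]].
rewrite inE; apply/andP; split.
  apply/forallP=> u; apply/forallP=> v; rewrite (eq_connect (grE f sf)).
  have cx w : connect (orient f) w x.
    apply: connect_sub (fx w) => y z /eqP <-; apply: connect1.
    by rewrite /orient eqxx.
  apply: connect_trans (cx u) _.
  by rewrite (sym_connect_sym (@orient_sym _ f)).
have := card_orient f; rewrite cV.
have -> : [set p : V * V | orient f p.1 p.2] = [set p | bip_adj (gr f) p.1 p.2].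
  by apply/setP=> p; rewrite !inE grE.
have -> : [set u | f (f u) == u] = set0.
  by apply/setP=> u; rewrite !inE (negPf (f2 u)).
rewrite card_bip_adj cards0; lia.
Qed.

(** * Random side-swapping maps *)

Section RandomFunction.

Variables (V : finType) (s : V -> bool).
Implicit Types (f : {ffun V -> V}) (U : {set V}) (v w z : V).

(** Invariance of an event under [upd f v] expresses its independence of the value at [v]. *)
Definition upd f v w : {ffun V -> V} := [ffun z => if z == v then w else f z].

Lemma upd_eq f v w : upd f v w v = w.
Proof. by rewrite ffunE eqxx. Qed.

Lemma upd_neq f v w z : z != v -> upd f v w z = f z.
Proof. by rewrite ffunE => /negPf->. Qed.

(** Divided by [count_fun predT], this is the probability of [P] when every value is drawn uniformly
    from the opposite side. *)
Definition count_fun (P : {ffun V -> V} -> bool) : nat :=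
  #|[set f : {ffun V -> V} | [forall v, s (f v) != s v] && P f]|.

Lemma eq_count_fun (P Q : {ffun V -> V} -> bool) :
  P =1 Q -> count_fun P = count_fun Q.
Proof. by move=> PQ; apply: eq_card => f; rewrite !inE PQ. Qed.

Lemma count_fun_pred0 : count_fun pred0 = 0%N.
Proof. by apply/eqP; rewrite cards_eq0; apply/eqP/setP => f; rewrite !inE andbF. Qed.

Lemma count_funD (P Q : {ffun V -> V} -> bool) :
  (count_fun (fun f => P f && ~~ Q f) + count_fun (fun f => P f && Q f)
    = count_fun P)%N.
Proof.
rewrite addnC /count_fun -[in RHS](cardsID [set f | Q f]).
congr (_ + _)%N; apply: eq_card => f; rewrite !inE.
  by rewrite andbA.
by rewrite andbA andbC.
Qed.

(** Overwriting the value at [v] is injective here, as all maps concerned agree at [v]. *)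
Lemma leq_count_upd (P : {ffun V -> V} -> bool) v w w' :
    (forall f u, P (upd f v u) = P f) -> s w' != s v ->
  (count_fun (fun f => (f v == w) && P f) <= count_fun (fun f => (f v == w') && P f))%N.
Proof.
move=> Pv sw'; rewrite /count_fun; set A := [set f | _].
rewrite -(card_in_imset (f := fun f => upd f v w') (D := A)).
  apply: subset_leq_card; apply/subsetP=> _ /imsetP[f fP ->].
  move: fP; rewrite /A !inE Pv upd_eq eqxx /= => /and3P[/forallP sf _ ->].
  rewrite andbT; apply/forallP=> z.
  by have [->|zv] := eqVneq z v; rewrite ?upd_eq ?upd_neq.
move=> f g; rewrite /A !inE => /and3P[_ /eqP fv _] /and3P[_ /eqP gv _] /ffunP fg.
apply/ffunP=> z; have [->|zv] := eqVneq z v; first by rewrite fv gv.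
by have := fg z; rewrite !upd_neq.
Qed.

(** Total probability over the value at [v], which is uniform on the opposite side and independent
    of each [Q w]. *)
Lemma count_fun_step v (Q : V -> {ffun V -> V} -> bool) :
    (forall w f u, Q w (upd f v u) = Q w f) ->
  (#|[set w | s w != s v]| * count_fun (fun f => Q (f v) f) =
     \sum_(w | s w != s v) count_fun (Q w))%N.
Proof.
move=> Qv.
have eqw w w' : s w != s v -> s w' != s v ->
    count_fun (fun f => (f v == w') && Q w f) = count_fun (fun f => (f v == w) && Q w f).
  by move=> sw sw'; apply/anti_leq; rewrite !leq_count_upd.
have part (P : {ffun V -> V} -> bool) :
    count_fun P = (\sum_(w' | s w' != s v) count_fun (fun f => (f v == w') && P f))%N.
  rewrite /count_fun -sum1_card.
  rewrite (partition_big (fun f : {ffun V -> V} => f v) (fun w => s w != s v)) /=.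
    apply: eq_bigr => w _; rewrite -sum1_card; apply: eq_bigl => f; rewrite !inE.
    by rewrite -andbA; congr (_ && _); rewrite andbC.
  by move=> f; rewrite inE => /andP[/forallP].
rewrite [count_fun _]part.
have -> : (\sum_(w' | s w' != s v) count_fun (fun f => (f v == w') && Q (f v) f) =
     \sum_(w' | s w' != s v) count_fun (fun f => (f v == w') && Q w' f))%N.
  by apply: eq_bigr => w _; apply: eq_count_fun => f; case: eqP => // ->.
rewrite big_distrr; apply: eq_bigr => w sw /=; rewrite (part (Q w)).
rewrite -sum_nat_const; rewrite (eq_bigl (fun w => s w != s v)); last by move=> ?; rewrite inE.
by apply: eq_bigr => w' sw'; rewrite (eqw w w').
Qed.

(** Steps start only in [U], so a walk stops on its first exit from [U]. *)
Definition exit_rel U (f : V -> V) : rel V := fun v w => (v \in U) && (f v == w).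

Definition leads U (f : V -> V) v w := connect (exit_rel U f) v w.

(** Equivalently, [U] contains no cycle of [f]: a walk that never exits becomes periodic inside
    [U]. *)
Definition escapes U (f : V -> V) :=
  [forall v, [exists w, (w \notin U) && leads U f v w]].

Lemma leadsE U (f : V -> V) v w : leads U f v w = (v == w) || (v \in U) && leads U f (f v) w.
Proof.
apply/connectP/idP => [[[|z p] /=]|].
- by move=> _ ->; rewrite eqxx.
- case/andP=> /andP[vU /eqP fv] pz lz; rewrite vU /=; apply/orP; right.
  by apply/connectP; exists p; rewrite fv.
case/orP=> [/eqP->|/andP[vU /connectP[p pp lp]]]; first by exists [::].
by exists (f v :: p); rewrite //= /exit_rel vU eqxx.
Qed.

Lemma leads_upd U f v u z w : v \notin U -> leads U (upd f v u) z w = leads U f z w.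
Proof.
move=> vU; apply: eq_connect => a b; rewrite /exit_rel ffunE.
by case: (eqVneq a v) => [->|//]; rewrite (negPf vU).
Qed.

Lemma escapes_upd U f v u : v \notin U -> escapes U (upd f v u) = escapes U f.
Proof.
by move=> vU; apply: eq_forallb => z; apply: eq_existsb => w; rewrite leads_upd.
Qed.

Lemma leads_notin U (f : V -> V) z w : z \notin U -> leads U f z w = (z == w).
Proof. by move=> /negPf zU; rewrite leadsE zU orbF. Qed.

Lemma leads_sub U U' (f : V -> V) z w : U \subset U' -> leads U f z w -> leads U' f z w.
Proof.
move=> /subsetP UU; apply: connect_sub => a b /andP[aU fa]; apply: connect1.
by rewrite /exit_rel UU.
Qed.

Lemma leads_ind U (f : V -> V) w (P : V -> Prop) :
    P w -> (forall z, z \in U -> P (f z) -> P z) ->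
  forall z, leads U f z w -> P z.
Proof.
move=> Pw PS z /connectP[p]; elim: p z => [|y p IH] z /=; first by move=> _ <-.
by case/andP=> /andP[zU /eqP fz] pp lp; apply: PS; rewrite ?fz //; exact: IH.
Qed.

Lemma leads_D1 U (f : V -> V) v z w : leads U f z w ->
  leads (U :\ v) f z w \/ leads (U :\ v) f z v.
Proof.
move: z; apply: leads_ind; first by left; exact: connect0.
move=> z zU IH; have [->|zv] := eqVneq z v; first by right; exact: connect0.
by case: IH => h; [left|right]; rewrite leadsE !inE zv zU h orbT.
Qed.

Lemma escapes_cycle U (f : V -> V) v w : v \in U -> leads (U :\ v) f (f v) v ->
  leads U f v w -> w \in U.
Proof.
move=> vU cyc /connectP[p pp ->].
have key x q : leads (U :\ v) f x v -> path (exit_rel U f) x q ->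
    leads (U :\ v) f (last x q) v.
  elim: q x => //= y q IH x xv /andP[/andP[xU /eqP fx] pq]; apply: IH pq.
  have [xv'|xv'] := eqVneq x v; first by rewrite -fx xv'.
  by move: xv; rewrite leadsE (negPf xv') fx => /andP[].
have := key v p (connect0 _ _) pp.
by rewrite leadsE => /orP[/eqP->//|/andP[]]; rewrite !inE => /andP[].
Qed.

(** Apart from its starting point [f v], the right-hand event does not depend on the value at [v];
    this makes conditioning on [f v] possible. *)
Lemma escapes_leads_D1 U (f : V -> V) v w : v \in U -> w \notin U ->
  escapes U f && leads U f v w = escapes (U :\ v) f && leads (U :\ v) f (f v) w.
Proof.
move=> vU wU; have wv : v != w by apply: contraNneq wU => <-.
apply/andP/andP=> -[/forallP eU vw]; split.
- apply/forallP=> z; have /existsP[y /andP[yU zy]] := eU z.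
  apply/existsP; case: (leads_D1 v zy) => h.
    by exists y; rewrite h !inE (negPf yU) andbF.
  by exists v; rewrite h !inE eqxx.
- have := vw; rewrite leadsE (negPf wv) vU /= => /(leads_D1 v)[//|cyc].
  by have := escapes_cycle vU cyc vw; rewrite (negPf wU).
- have sub := subsetDl U [set v].
  have vw' : leads U f v w by rewrite leadsE vU (leads_sub sub vw) orbT.
  apply/forallP=> z; have /existsP[y /andP[yU zy]] := eU z; apply/existsP.
  move: yU; rewrite !inE negb_and negbK => /orP[/eqP yv|yU].
    by exists w; rewrite wU; apply: connect_trans vw'; rewrite -yv; apply: leads_sub zy.
  by exists y; rewrite yU (leads_sub sub zy).
- by rewrite leadsE vU (leads_sub (subsetDl U [set v]) vw) orbT.
Qed.

(** Any cycle created by putting [v] back passes through [v]. The probability for [U] thus becomes a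
    difference of two probabilities for [U :\ v]. *)
Lemma escapes_D1 U (f : V -> V) v : v \in U ->
  escapes U f = escapes (U :\ v) f && ~~ leads (U :\ v) f (f v) v.
Proof.
move=> vU; apply/idP/andP=> [eU|[eU cyc]].
  have /existsP[w /andP[wU vw]] := forallP eU v.
  have := escapes_leads_D1 f vU wU; rewrite eU vw => /esym/andP[-> _]; split=> //.
  by apply: contraNN wU => cyc; exact: escapes_cycle cyc vw.
have /existsP[w /andP[wU vw]] := forallP eU (f v).
have wU' : w \notin U.
  move: wU; rewrite !inE negb_and negbK => /orP[/eqP wv|//].
  by move: vw cyc; rewrite wv => ->.
by have := escapes_leads_D1 f vU wU'; rewrite eU vw => /andP[].
Qed.

End RandomFunction.

(** * The probability that a vertex set contains no cycle *)

Section EscapeProbability.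

Local Open Scope ring_scope.

Variables (F : numFieldType) (V : finType) (s : V -> bool).
Implicit Types (U : {set V}) (v w z : V).

Definition side (b : bool) : {set V} := [set w | s w == b].
Definition count_side U b : nat := #|U :&: side b|.

Hypothesis side_gt0 : forall b, (0 < #|side b|)%N.

Let N (P : {ffun V -> V} -> bool) : F := (count_fun s P)%:R.
Let T : F := N predT.
Let c (b : bool) : F := #|side b|%:R.

Let c_neq0 b : c b != 0.
Proof. by rewrite pnatr_eq0 -lt0n. Qed.

Let N0 P : P =1 pred0 -> N P = 0.
Proof. by move/(eq_count_fun s) => NP; rewrite /N NP count_fun_pred0. Qed.

Lemma count_prob_step v (Q : V -> {ffun V -> V} -> bool) :
    (forall w f u, Q w (upd f v u) = Q w f) ->
  N (fun f => Q (f v) f) = (\sum_(w | s w == ~~ s v) N (Q w)) / c (~~ s v).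
Proof.
move=> Qv; apply/eqP; rewrite eq_sym (can2_eq (mulfVK (c_neq0 _)) (mulfK (c_neq0 _))).
rewrite -natr_sum -natrM eqr_nat mulnC; apply/eqP.
have -> : #|side (~~ s v)| = #|[set w | s w != s v]|.
  by apply: eq_card => w; rewrite !inE; case: (s w) (s v) => [] [].
rewrite (count_fun_step s Qv); apply: eq_bigl => w.
by case: (s w) (s v) => [] [].
Qed.

Lemma count_side_D1 U v b : v \in U ->
  count_side U b = (count_side (U :\ v) b + (s v == b))%N.
Proof.
move=> vU; rewrite /count_side (cardsD1 v (U :&: _)) !inE vU addnC; congr (_ + _)%N.
by apply: eq_card => w; rewrite !inE andbA.
Qed.

Lemma sum_count_side U b (x : F) : \sum_(w in U | s w == b) x = (count_side U b)%:R * x.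
Proof.
rewrite mulr_natl -sumr_const; apply: eq_bigl => w.
by rewrite !inE.
Qed.

(* A one-vertex-at-a-time induction: both sides of [escapes_leads_D1] are
   evaluated by conditioning on [f v], and the three formulas close up. *)
Lemma count_escapes U :
  N (escapes U) = T * (1 - (count_side U true)%:R * (count_side U false)%:R / (c true * c false))
  /\ forall v w, v \in U -> w \notin U ->
     N (fun f => escapes U f && leads U f v w) =
     if s v == s w then T * (count_side U (~~ s w))%:R / (c true * c false)
     else T / c (s w).
Proof.
have [n] := ubnP #|U|; elim: n U => // n IH U Un.
have [ct cf] : c true != 0 /\ c false != 0 by [].
(* The case [w = v] is included: it is the event that [v] closes a cycle. *)
have step v w : v \in U -> w \notin U :\ v ->
    N (fun f => escapes (U :\ v) f && leads (U :\ v) f (f v) w) =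
    (if s v == s w then T * (count_side U (~~ s w))%:R / (c true * c false)
     else T / c (s w)).
  move=> vU wU'.
  have [IH1 IH2] : _ := IH (U :\ v) ltac:(by rewrite (cardsD1 v) vU in Un; lia).
  have vU' : v \notin U :\ v by rewrite !inE eqxx.
  rewrite (@count_prob_step v (fun z f => escapes (U :\ v) f && leads (U :\ v) f z w));
    last by move=> z f u; rewrite escapes_upd ?leads_upd.
  rewrite (bigID (mem (U :\ v))) /=.
  (* A walk from [z] outside [U :\ v] has already stopped, so only [z = w] contributes, and only if
     [w] is opposite to [v]. *)
  have -> : \sum_(z | (s z == ~~ s v) && (z \notin U :\ v))
       N (fun f => escapes (U :\ v) f && leads (U :\ v) f z w) =
     if s v == s w then 0 else N (escapes (U :\ v)).
    case: ifP => vw.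
      apply: big1 => z /andP[/eqP sz zU]; apply: N0 => f; rewrite leads_notin //.
      case: eqP => [zw|]; last by rewrite andbF.
      by move: vw; rewrite -zw sz; case: (s v).
    rewrite (bigD1 w) /=; last by rewrite wU' andbT; case: (s v) (s w) vw => [] [].
    rewrite big1 ?addr0; first by congr _%:R; apply: eq_count_fun => f; rewrite leads_notin ?eqxx ?andbT.
    move=> z /andP[/andP[_ zU] zw]; apply: N0 => f.
    by rewrite leads_notin // (negPf zw) andbF.
  rewrite (eq_bigl (fun z => (z \in U :\ v) && (s z == ~~ s v))); last by move=> z; rewrite andbC.
  rewrite (eq_bigr (fun _ => if s v == s w then T / c (s w) else
     T * (count_side (U :\ v) (~~ s w))%:R / (c true * c false))); last first.
    move=> z /andP[zU /eqP sz]; rewrite IH2 // sz.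
    by case: (s v) (s w) => [] [].
  rewrite sum_count_side IH1 !(count_side_D1 _ vU).
  case: (s v) (s w) => [] [] /=; rewrite ?addn0 ?addr0; field; rewrite ?ct ?cf //.
split; last first.
  move=> v w vU wU; rewrite -(step v w vU); last by rewrite !inE (negPf wU) andbF.
  by congr _%:R; apply: eq_count_fun => f; exact: escapes_leads_D1.
have [->|[v vU]] := set_0Vmem U.
  rewrite /count_side set0I cards0 mul0r mul0r subr0 mulr1; congr _%:R.
  apply: eq_count_fun => f; apply/forallP=> z; apply/existsP; exists z.
  by rewrite inE; exact: connect0.
have [IH1 _] : _ := IH (U :\ v) ltac:(by rewrite (cardsD1 v) vU in Un; lia).
have vU' : v \notin U :\ v by rewrite !inE eqxx.
have -> : N (escapes U) = N (escapes (U :\ v)) -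
     N (fun f => escapes (U :\ v) f && leads (U :\ v) f (f v) v).
  apply/eqP; rewrite -subr_eq opprK /N -natrD eqr_nat; apply/eqP.
  rewrite -[RHS](count_funD s _ (fun f => leads (U :\ v) f (f v) v)); congr (_ + _)%N.
  by apply: eq_count_fun => f; exact: escapes_D1.
rewrite step // eqxx IH1 !(count_side_D1 _ vU).
by case: (s v); rewrite /= ?addn0; field; rewrite ?ct ?cf.
Qed.

End EscapeProbability.

(** * Counting by cycles *)

(* With [D] the vertices visited so far and [v] the last of them: [f] visits [k] new
   vertices after [v], then returns to [x], and all other vertices flow to this cycle. *)
Fixpoint closes (V : finType) (x : V) (k : nat) (D : {set V}) (v : V) (f : V -> V) : bool :=
  if k is k'.+1 then (f v \notin D) && closes x k' (f v |: D) (f v) f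
  else (f v == x) && escapes (~: D) f.

(** Among the visited vertices, only the last one still has its value read. *)
Lemma closes_upd (V : finType) (x : V) k (D : {set V}) v (f : {ffun V -> V}) u z :
  u \in D -> u != v -> closes x k D v (upd f u z) = closes x k D v f.
Proof.
move=> uD; elim: k D v uD => [|k IH] D v uD uv /=.
  by rewrite escapes_upd ?inE ?uD // upd_neq // eq_sym.
rewrite upd_neq; last by rewrite eq_sym.
have [//|fD] := boolP (f v \in D); rewrite IH ?inE ?uD ?orbT //.
by apply: contraNneq fD => <-.
Qed.

(** The visited set is always the trajectory so far, so the successive freshness tests amount to
    uniqueness of the extended trajectory. *)
Lemma closes_traject (V : finType) (x : V) k m (f : V -> V) :
  uniq (traject f x m.+1) ->
  closes x k [set y in traject f x m.+1] (iter m f x) f =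
  [&& uniq (traject f x (m + k).+1), iter (m + k).+1 f x == x
    & escapes (~: [set y in traject f x (m + k).+1]) f].
Proof.
elim: k m => [|k IH] m um; first by rewrite addn0 um.
have DE : f (iter m f x) |: [set y in traject f x m.+1] = [set y in traject f x m.+2].
  by apply/setP=> y; rewrite in_setU1 !in_set [in RHS]trajectSr mem_rcons in_cons.
rewrite [LHS]/= DE addnS -addSn.
have : uniq (traject f x m.+2) = (f (iter m f x) \notin [set y in traject f x m.+1]).
  by rewrite [in LHS]trajectSr rcons_uniq um andbT in_set.
have [um2 /esym fD|/negP um2 /esym /negbFE fD] := boolP (uniq (traject f x m.+2)).
  by rewrite fD -IH.
rewrite fD /=; apply/esym/negbTE/negP => /and3P[uu _ _]; apply: um2.
have <- := @take_traject _ f (m.+1 + k).+1 m.+2 x ltac:(lia); exact: take_uniq.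
Qed.

Lemma closesP (V : finType) (x : V) k (f : V -> V) :
  closes x k [set x] x f = (order f x == k.+1) && [forall v, fconnect f v x].
Proof.
have -> : [set x] = [set y in traject f x 1] by apply/setP=> y; rewrite !inE.
rewrite (@closes_traject V x k 0) //; apply/and3P/andP; rewrite add0n.
  move=> [ut /eqP itx esc]; have cyc : fcycle f (traject f x k.+1).
    have -> : traject f x k.+1 = x :: traject f (f x) k by [].
    rewrite /cycle; have <- : traject f (f x) k.+1 = rcons (traject f (f x) k) x.
      by rewrite trajectSr -iterSr itx.
    exact: fpath_traject.
  have xt : x \in traject f x k.+1 by rewrite inE eqxx.
  rewrite (order_cycle cyc ut xt) size_traject eqxx; split=> //.
  apply/forallP=> v; have /existsP[w /andP[]] := forallP esc v.
  rewrite !inE negbK => wt vw; apply: (@connect_trans _ _ w).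
    by apply: connect_sub vw => a b /andP[_ /eqP <-]; exact: fconnect1.
  by rewrite (fconnect_cycle cyc).
move=> [/eqP ok /forallP fx]; have cyc : fcycle f (orbit f x) by rewrite -fconnect_f.
have oE : traject f x k.+1 = orbit f x by rewrite /orbit ok.
rewrite oE orbit_uniq -ok (iter_order_cycle cyc) ?in_orbit //; split=> //.
apply/forallP=> v; have := iter_findex (fx v).
move: (findex f v x) => n; elim: n v => [|n IH] v /= fvx.
  by apply/existsP; exists v; rewrite !inE negbK fvx in_orbit /leads connect0.
have [vo|vo] := boolP (v \in orbit f x).
  by apply/existsP; exists v; rewrite !inE negbK vo /leads connect0.
have /existsP[w /andP[wo fvw]] : [exists w, (w \notin ~: [set y in orbit f x]) &&
   leads (~: [set y in orbit f x]) f (f v) w] by apply: IH; rewrite -iterSr.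
by apply/existsP; exists w; rewrite wo leadsE !inE vo fvw orbT.
Qed.

(* The cycle of a side-swapping map is even, hence of length [2 * r], and each
   of its vertices is counted with weight [1 / (2 * r)]. *)
Lemma unicyclic_weight (F : numFieldType) (V : finType) (s : V -> bool) (f : V -> V) :
    (forall v, s (f v) != s v) ->
  ((unicyclic s f)%:R = \sum_(2 <= r < #|V|.+1)
    (\sum_x (closes x (2 * r).-1 [set x] x f)%:R) / (2 * r)%:R :> F)%R.
Proof.
move=> sf; rewrite /unicyclic; have -> /= : [forall v, s (f v) != s v] by apply/forallP.
case: (boolP [exists x, _]) => [/existsP[x0 /forallP fx0]|no]; last first.
  rewrite andbF big1 // => r _; rewrite big1 ?GRing.mul0r // => x _.
  rewrite closesP; case: andP => // -[_ h].
  by case/negP: no; apply/existsP; exists x.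
rewrite andbT.
have cyc : fcycle f (orbit f x0) by rewrite -fconnect_f.
have x0o := in_orbit f x0.
have sit n x : s (iter n f x) = s x (+) odd n.
  elim: n => [|n IH] /=; first by rewrite addbF.
  have := sf (iter n f x); rewrite IH.
  by case: (s (f _)) (s x) (odd n) => [] [] [].
set l := order f x0; have itl : iter l f x0 = x0 := iter_order_cycle cyc x0o x0o.
have evl : ~~ odd l by have := sit l x0; rewrite itl; case: (s x0) (odd l) => [] [].
have [r0 lr0] : exists r0, l = (2 * r0)%N by exists l./2; rewrite mul2n even_halfK.
have r00 : (0 < r0)%N by have := order_gt0 f x0; rewrite -/l; lia.
have r0V : (r0 < #|V|.+1)%N.
  have : (l <= #|V|)%N by rewrite /l /order max_card.
  lia.
(* Since everything flows to one cycle, a [v] with [f (f v) = v] forces that cycle to have length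
   2. *)
have two : [forall v, f (f v) != v] = (1 < r0)%N.
  apply/forallP/idP => [f2|r1 v].
    rewrite ltn_neqAle r00 andbT; apply/eqP=> r1; move: itl; rewrite lr0 -r1 /=.
    by apply/eqP; exact: f2.
  apply/eqP=> fv; have fx02 : f (f x0) = x0.
    have : x0 \in [:: v; f v].
      rewrite -(iter_findex (fx0 v)); elim: (findex _ _ _) => [|n]; rewrite ?inE ?eqxx //=.
      by case/orP=> /eqP->; rewrite ?fv eqxx ?orbT.
    by rewrite !inE => /orP[] /eqP ->; rewrite ?fv.
  have := orbit_uniq f x0; rewrite /orbit -/l lr0.
  have -> : (2 * r0)%N = (2 * r0 - 3).+3 by lia.
  by rewrite /= fx02 !inE eqxx orbT.
(* The vertices [x] that count are the [2 * r0] vertices of the cycle, and they count only at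
   [r = r0]. *)
have inner r : (0 < r)%N ->
    (\sum_x (closes x (2 * r).-1 [set x] x f)%:R = ((r == r0) * (2 * r0)%N)%:R :> F)%R.
  move=> r_gt0; rewrite -GRing.natr_sum; congr (_%:R)%R.
  rewrite -lr0 /l -(size_orbit f x0) -(card_uniqP (orbit_uniq f x0)).
  rewrite [RHS]mulnC -sum_nat_const [RHS]big_mkcond /=; apply: eq_bigr => x _.
  rewrite closesP; have -> : (2 * r).-1.+1 = (2 * r)%N by lia.
  case: ifP => xo.
    rewrite (eq_order_cycle cyc x0o xo) -/l lr0 eqn_pmul2l // eq_sym.
    have -> : [forall v, fconnect f v x]; last by rewrite andbT.
    by apply/forallP=> v; apply: connect_trans (fx0 v) _; rewrite (fconnect_cycle cyc).
  case: andP => // -[_ /forallP/(_ x0)].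
  by rewrite fconnect_orbit xo.
rewrite two; case: ltnP => r01.
  rewrite (bigD1_seq r0) ?mem_index_iota ?iota_uniq ?r01 //= inner ?eqxx //.
  rewrite mul1n GRing.divff ?Num.Theory.pnatr_eq0; last by lia.
  rewrite big1_seq ?GRing.addr0 // => r /andP[rr0]; rewrite mem_index_iota => /andP[r2 _].
  by rewrite inner ?(negPf rr0) ?GRing.mul0r //; lia.
rewrite big1_seq // => r /andP[_]; rewrite mem_index_iota => /andP[r2 _].
rewrite inner; last by lia.
by case: eqP => [?|]; [lia | rewrite GRing.mul0r].
Qed.

(** * Maps whose only cycle has a prescribed length *)

Section CycleCount.

Local Open Scope ring_scope.

Variables (F : numFieldType) (V : finType) (s : V -> bool).
Hypothesis side_gt0 : forall b, (0 < #|side s b|)%N.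

Let N (P : {ffun V -> V} -> bool) : F := (count_fun s P)%:R.
Let c (b : bool) : F := #|side s b|%:R.

Let c_neq0 b : c b != 0.
Proof. by rewrite pnatr_eq0 -lt0n. Qed.

Lemma count_closes_step (x : V) k (D : {set V}) (v : V) (y : F) : v \in D ->
    (forall w, w \notin D -> s w = ~~ s v ->
       N (fun f => closes x k (w |: D) w f) = y) ->
  N (fun f => closes x k.+1 D v f) = (count_side s (~: D) (~~ s v))%:R * y / c (~~ s v).
Proof.
move=> vD Ny.
rewrite /N (@count_prob_step _ _ _ side_gt0 v
  (fun w f => (w \notin D) && closes x k (w |: D) w f)); last first.
  move=> w f u; have [//|wD] := boolP (w \in D).
  rewrite closes_upd // ?inE ?vD ?orbT //; by apply: contraNneq wD => <-.
congr (_ / _); rewrite -sum_count_side (bigID (mem D)) /= big1 ?add0r.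
  rewrite [RHS](eq_bigl (fun w => (s w == ~~ s v) && (w \notin D))).
    apply: eq_bigr => w /andP[/eqP sw wD]; rewrite -(Ny w wD sw) /N.
    by congr _%:R; apply: eq_count_fun => f; rewrite wD.
  by move=> w; rewrite inE andbC.
move=> w /andP[_ wD]; have -> : 0 = (count_fun s pred0)%:R :> F by rewrite count_fun_pred0.
by congr _%:R; apply: eq_count_fun => f; rewrite wD.
Qed.

Lemma count_side_setU1 (D : {set V}) w b : w \notin D ->
  count_side s (~: D) b = (count_side s (~: (w |: D)) b + (s w == b))%N.
Proof.
move=> wD; rewrite (@count_side_D1 _ s _ w) ?inE //; congr (_ + _)%N.
by congr (count_side s _ b); apply/setP => z; rewrite !inE negb_or.
Qed.

(** The walk picks [t.+1] fresh vertices opposite to [x] and [t] on the side of [x], whence the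
    falling factorials; with the return to [x] this prescribes [2 * t.+1] values. The last factor is
    the escape probability of the unvisited rest. *)
Lemma count_closes (x : V) t (D : {set V}) (v : V) : v \in D -> s v = s x ->
  let m := count_side s (~: D) (s x) in let n := count_side s (~: D) (~~ s x) in
  N (fun f => closes x (2 * t).+1 D v f) =
    N predT * ((n ^_ t.+1)%:R * (m ^_ t)%:R) / (c (s x) * c (~~ s x)) ^+ t.+1
    * (1 - (m - t)%:R * (n - t.+1)%:R / (c (s x) * c (~~ s x))).
Proof.
elim: t D v => [|t IH] D v vD sv m n.
  (* The factor [1 / c (s x)] is the chance that the single new vertex is sent back to [x]. *)
  rewrite (count_closes_step (y := N predT / c (s x) *
     (1 - m%:R * (n - 1)%:R / (c (s x) * c (~~ s x))))) //.
    rewrite sv -/n ffactn1 ffactn0 subn0; field.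
    by rewrite !c_neq0.
  move=> w wD sw; rewrite /= /N.
  rewrite (@count_prob_step _ _ _ side_gt0 w (fun z f => (z == x) && escapes (~: (w |: D)) f));
    last by move=> z f u; rewrite escapes_upd // !inE eqxx.
  rewrite (bigD1 x) ?sw ?sv ?negbK //= big1 ?addr0; last first.
    move=> z /andP[_ /negPf zx]; have -> : 0 = (count_fun s pred0)%:R :> F by rewrite count_fun_pred0.
    by congr _%:R; apply: eq_count_fun => f; rewrite zx.
  have -> : (count_fun s (fun f => (x == x) && escapes (~: (w |: D)) f)) =
            count_fun s (escapes (~: (w |: D))).
    by apply: eq_count_fun => f; rewrite eqxx.
  rewrite (count_escapes _ side_gt0 _).1.
  have mE := count_side_setU1 (s x) wD; have nE := count_side_setU1 (~~ s x) wD.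
  rewrite /m /n mE nE sw sv eqxx; case: (s x) => /=; rewrite ?addn0 ?addnK;
    rewrite /N; field; rewrite ?c_neq0 //.
(* Two steps at once: a fresh vertex opposite to [x], then one on the side of [x]; the induction
   hypothesis applies with both counts one less. *)
rewrite mulnS (count_closes_step (y := m%:R / c (s x) *
   (N predT * (((n.-1) ^_ t.+1)%:R * ((m.-1) ^_ t)%:R) / (c (s x) * c (~~ s x)) ^+ t.+1
    * (1 - (m.-1 - t)%:R * (n.-1 - t.+1)%:R / (c (s x) * c (~~ s x)))))) //.
  rewrite sv -/n !ffactnS (exprS _ t.+1) !natrM.
  have -> : (m.-1 - t = m - t.+1)%N by lia.
  have -> : (n.-1 - t.+1 = n - t.+2)%N by lia.
  field; rewrite ?expf_neq0 ?mulf_neq0 ?c_neq0 //.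
move=> w wD sw.
have mE := count_side_setU1 (s x) wD; have nE := count_side_setU1 (~~ s x) wD.
rewrite sw sv in mE nE; rewrite eqxx in nE.
have {}mE : m = count_side s (~: (w |: D)) (s x).
  by rewrite /m mE; case: (s x); rewrite /= addn0.
rewrite (count_closes_step (y := N predT * (((n.-1) ^_ t.+1)%:R * ((m.-1) ^_ t)%:R) / (c (s x) * c (~~ s x)) ^+ t.+1
    * (1 - (m.-1 - t)%:R * (n.-1 - t.+1)%:R / (c (s x) * c (~~ s x))))) ?inE ?eqxx //.
  rewrite sw sv negbK -mE; field; rewrite ?expf_neq0 ?mulf_neq0 ?c_neq0 //.
move=> w' wD' sw'; rewrite IH ?inE ?eqxx //; last by rewrite sw' sw sv negbK.
have mE' := count_side_setU1 (s x) wD'; have nE' := count_side_setU1 (~~ s x) wD'.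
rewrite sw' sw sv negbK eqxx in mE' nE'.
have -> : m.-1 = count_side s (~: (w' |: (w |: D))) (s x) by rewrite mE mE' addn1.
suff -> : n.-1 = count_side s (~: (w' |: (w |: D))) (~~ s x) by [].
rewrite /n nE nE' addn1 /=.
by case: (s x); rewrite /= addn0.
Qed.

(** With sides of sizes [p] and [q], summing over [x] completes the falling factorial of [p - 1] or
    [q - 1], and both sides contribute equally. Since [1 - (p - r) (q - r) / (p q) = r (p + q - r) /
    (p q)], the weight [1 / (2 r)] cancels. *)
Lemma count_unicyclic :
  N (fun f => unicyclic s f) = N predT * \sum_(2 <= r < (minn #|side s true| #|side s false|).+1)
     ((#|side s true| ^_ r)%:R * (#|side s false| ^_ r)%:R) / (c true ^+ r * c false ^+ r)
     * (c true + c false - r%:R) / (c true * c false).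
Proof.
pose W := [set f : {ffun V -> V} | [forall v, s (f v) != s v]].
have NE (P : {ffun V -> V} -> bool) : N P = \sum_(f in W) (P f)%:R.
  rewrite -natr_sum; congr _%:R; rewrite /count_fun -sum1_card.
  under eq_bigl do rewrite !inE.
  rewrite big_mkcondr /=.
  by under [RHS]eq_bigl do rewrite !inE.
rewrite NE; transitivity (\sum_(f in W) \sum_(2 <= r < #|V|.+1)
    (\sum_x (closes x (2 * r).-1 [set x] x f)%:R) / (2 * r)%:R : F).
  by apply: eq_bigr => f; rewrite inE => /forallP sf; exact: unicyclic_weight.
rewrite exchange_big /=.
have cV : #|V| = (#|side s true| + #|side s false|)%N.
  rewrite -cardsT -(cardsID (side s true)) setTI; congr (_ + _)%N.
  by apply: eq_card => v; rewrite !inE andbT; case: (s v).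
rewrite big_distrr /=.
set p := #|side s true| in cV *; set q := #|side s false| in cV *.
have p0 : (0 < p)%N := side_gt0 true; have q0 : (0 < q)%N := side_gt0 false.
(* The range shrinks to [r <= minn p q], as a falling factorial vanishes beyond. *)
transitivity (\sum_(2 <= r < #|V|.+1)
   N predT * ((p ^_ r)%:R * (q ^_ r)%:R / (c true ^+ r * c false ^+ r)
     * (c true + c false - r%:R) / (c true * c false))); last first.
  rewrite (big_cat_nat (n := (minn p q).+1)) /=; [|lia|by rewrite cV ltnS (leq_trans (geq_minl p q)) // leq_addr].
  rewrite [X in _ + X]big1_seq ?addr0 // => r /andP[_]; rewrite mem_index_iota => /andP[rm _].
  have [/(ffact_small)->|qr] := ltnP p r; first by rewrite mul0r !mul0r mulr0.
  by have [/(ffact_small)->|pr] := ltnP q r; [rewrite mulr0 !mul0r mulr0 | lia].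
apply: eq_big_nat => r /andP[r2 rV].
have inner b (x : V) : s x = b -> \sum_(f in W) (closes x (2 * r).-1 [set x] x f)%:R =
    N predT * ((#|side s (~~ b)| ^_ r)%:R * (#|side s b|.-1 ^_ r.-1)%:R) /
    (c b * c (~~ b)) ^+ r *
    (1 - (#|side s b| - r)%:R * (#|side s (~~ b)| - r)%:R / (c b * c (~~ b))).
  move=> sx; rewrite -NE; have -> : ((2 * r).-1 = (2 * r.-1).+1)%N by lia.
  rewrite (count_closes _ (D := [set x])) ?inE //= sx.
  have -> : count_side s (~: [set x]) (~~ b) = #|side s (~~ b)|.
    by apply: eq_card => z; rewrite !inE; case: eqP => // ->; rewrite sx; case: b sx.
  have -> : count_side s (~: [set x]) b = #|side s b|.-1.
    rewrite (cardsD1 x (side s b)) !inE sx eqxx /=.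
    by apply: eq_card => z; rewrite !inE.
  have -> : r.-1.+1 = r by lia.
  by have -> : (#|side s b|.-1 - r.-1 = #|side s b| - r)%N by lia.
rewrite -big_distrl /= exchange_big /= (bigID (fun x => s x)) /=.
rewrite (eq_bigr _ (fun x => inner true x)) [X in _ + X](eq_bigr (fun _ : V => 
  N predT * ((#|side s true| ^_ r)%:R * (#|side s false|.-1 ^_ r.-1)%:R) /
    (c false * c true) ^+ r *
    (1 - (#|side s false| - r)%:R * (#|side s true| - r)%:R / (c false * c true)))); last first.
  by move=> x /negbTE; exact: inner.
rewrite !sumr_const.
have -> : #|[pred x | s x]| = p by apply: eq_card => x; rewrite !inE; case: (s x).
have -> : #|[pred x | ~~ s x]| = q by apply: eq_card => x; rewrite !inE; case: (s x).
have pf n : (n.-1 ^_ r.-1)%:R * n%:R = (n ^_ r)%:R :> F.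
  by rewrite -natrM mulnC -ffactnS; congr (_ ^_ _)%:R; lia.
have zero a b e t n : a = 0 \/ b = 0 -> N predT * (a * b) / e * t *+ n = 0.
  by case=> ->; rewrite ?mul0r ?mulr0 !mul0r mul0rn.
(* The truncated differences [p - r] and [q - r] are genuine only for [r <= minn p q]; otherwise
   both sides of the identity are 0. *)
have [pr|rp] := ltnP p r.
  rewrite [(_ : F) *+ p]zero; last by right; rewrite ffact_small //; lia.
  rewrite [(_ : F) *+ q]zero; last by left; rewrite ffact_small.
  by rewrite (ffact_small pr) addr0 !mul0r mulr0.
have [qr|rq] := ltnP q r.
  rewrite [(_ : F) *+ p]zero; last by left; rewrite ffact_small.
  rewrite [(_ : F) *+ q]zero; last by right; rewrite ffact_small //; lia.
  by rewrite (ffact_small qr) mulr0 addr0 !mul0r mulr0.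
rewrite -[_ *+ p]mulr_natr -[_ *+ q]mulr_natr -(pf p) -(pf q).
rewrite (natrB F rp) (natrB F rq) (natrM F 2 r) /c -/p -/q !exprMn.
have r0 : r%:R != 0 :> F by rewrite pnatr_eq0; lia.
have pn0 : p%:R != 0 :> F := c_neq0 true.
have qn0 : q%:R != 0 :> F := c_neq0 false.
by field; rewrite ?expf_neq0 ?r0 ?pn0 ?qn0.
Qed.

End CycleCount.

(** * The number of side-swapping maps and the exact formula *)

Lemma count_fun_predT (V : finType) (s : V -> bool) :
  count_fun s predT = (#|side s false| ^ #|side s true| * #|side s true| ^ #|side s false|)%N.
Proof.
transitivity #|family (fun v => side s (~~ s v))|.
  apply: eq_card => f; rewrite !inE andbT; apply/forallP/familyP => sf v; have := sf v;
    by rewrite !inE; case: (s v) (s (f v)) => [] [].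
rewrite card_family foldrE big_image /= (bigID s) /=; congr (_ * _)%N.
  rewrite (eq_bigr (fun _ => #|side s false|)); last by move=> v ->.
  rewrite prod_nat_const; congr (_ ^ _)%N; apply: eq_card => v.
  by rewrite !inE eqb_id.
rewrite (eq_bigr (fun _ => #|side s true|)); last by move=> v /negPf ->.
rewrite prod_nat_const; congr (_ ^ _)%N; apply: eq_card => v.
by rewrite !inE eqbF_neg.
Qed.

Lemma card_left_side (i j : nat) : #|side (@left_side i j) true| = i.
Proof.
rewrite -[RHS]card_ord -(card_imset predT (@inl_inj 'I_i 'I_j)).
apply: eq_card => -[x|x]; rewrite !inE /=; apply/esym; first by apply/imsetP; exists x.
by apply/imsetP => -[].
Qed.

Lemma card_right_side (i j : nat) : #|side (@left_side i j) false| = j.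
Proof.
rewrite -[RHS]card_ord -(card_imset predT (@inr_inj 'I_i 'I_j)).
apply: eq_card => -[x|x]; rewrite !inE /=; apply/esym; last by apply/imsetP; exists x.
by apply/imsetP => -[].
Qed.

Local Open Scope ring_scope.

(** There are [i ^ j * j ^ i] side-swapping maps; the denominator [i * j] of the escape probability
    lowers both exponents by one, and the half comes from the two orientations. *)
Lemma bip_count0E (F : numFieldType) (i j : nat) : (0 < i)%N -> (0 < j)%N ->
  (bip_count i j 0)%:R =
       2^-1 * i%:R ^+ (j - 1) * j%:R ^+ (i - 1) *
       \sum_(2 <= r < (minn i j).+1)
          ((i ^_ r)%:R * (j ^_ r)%:R) / (i%:R ^+ r * j%:R ^+ r) *
          (i%:R + j%:R - r%:R) :> F.
Proof.
move=> i0 j0.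
have side0 b : (0 < #|side (@left_side i j) b|)%N.
  by case: b; rewrite ?card_left_side ?card_right_side.
have h2 : 2%:R != 0 :> F by rewrite pnatr_eq0.
apply: (mulfI h2); rewrite -natrM bip_count_unicyclic //.
have -> : #|[set f : {ffun 'I_i + 'I_j -> 'I_i + 'I_j} | unicyclic (@left_side i j) f]|
    = count_fun (@left_side i j) (fun f => unicyclic (@left_side i j) f).
  apply: eq_card => f; rewrite !inE; apply/idP/andP => [|[]//].
  by move=> uf; split=> //; case/and3P: uf.
rewrite (count_unicyclic F side0) count_fun_predT card_left_side card_right_side.
have i0' : i%:R != 0 :> F by rewrite pnatr_eq0 -lt0n.
have j0' : j%:R != 0 :> F by rewrite pnatr_eq0 -lt0n.
rewrite -mulr_suml natrM !natrX.
have pw n m : (0 < m)%N -> n%:R ^+ m = n%:R * n%:R ^+ (m - 1) :> F.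
  by move=> m0; rewrite -exprS; congr (_ ^+ _); lia.
rewrite (pw j i) // (pw i j) //.
set S := (X in _ * (X / _) = _); rewrite -/S.
by field; rewrite i0' j0'.
Qed.

From mathcomp Require Import all_classical all_reals all_analysis.
Import numFieldNormedType.Exports.

Local Open Scope classical_set_scope.

(** * Comparison with the Gauss integral *)

Section GaussSum.
Variable R : realType.
Implicit Types x y h : R.

Local Notation mu := (@lebesgue_measure R).
Local Notation I := (@gauss_integral_proof.integral0_gauss R).

Lemma le_gauss_fun x y : 0 <= x -> x <= y -> gauss_fun y <= gauss_fun x.
Proof.
by move=> x0 xy; rewrite /gauss_fun ler_expR lerN2 ler_sqr // nnegrE ?(le_trans x0).
Qed.

Lemma integral0_gauss_increment x y : 0 <= x -> x <= y ->
  (y - x) * gauss_fun y <= I y - I x <= (y - x) * gauss_fun x.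
Proof.
move=> x0 xy.
have ci (f : R -> R) a b : continuous f -> mu.-integrable `[a, b] (EFin \o f).
  move=> cf; apply: continuous_compact_integrable; first exact: segment_compact.
  exact: continuous_subspaceT.
have ci' (f : R -> R) : continuous f -> mu.-integrable `]x, y] (EFin \o f).
  move=> cf; apply: (integrableS _ _ _ (ci f x y cf)) => //.
  exact: subset_itv_oc_cc.
have cg : continuous (@gauss_fun R) by exact: continuous_gauss_fun.
have cc (c : R) : continuous (fun _ : R => c) by exact: cst_continuous.
rewrite /gauss_integral_proof.integral0_gauss Rintegral_itvB ?bnd_simp //; last exact: ci.
have Ec c : \int[mu]_(t in `]x, y]) c = (y - x) * c.
  rewrite Rintegral_cst // mulrC; congr (_ * _).
  rewrite /= lebesgue_measure_itv /= lte_fin; case: ltgtP xy => // ->.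
  by rewrite subrr.
apply/andP; split; rewrite -Ec; apply: le_Rintegral => //; try exact: ci'.
  by move=> t /=; rewrite in_itv /= => /andP[xt ty]; rewrite le_gauss_fun // (le_trans x0 (ltW xt)).
by move=> t /=; rewrite in_itv /= => /andP[xt ty]; rewrite le_gauss_fun // ltW.
Qed.

Lemma integral0_gauss0 : I 0 = 0.
Proof. by rewrite /gauss_integral_proof.integral0_gauss set_itv1 Rintegral_set1. Qed.

Lemma integral0_gauss_le x : 0 <= x -> I x <= x.
Proof.
move=> x0; have /andP[_] := integral0_gauss_increment (lexx 0) x0.
rewrite integral0_gauss0 !subr0 => /le_trans; apply.
by rewrite ler_piMr // gauss_fun_le1.
Qed.

Lemma integral0_gauss_homo x y : 0 <= x -> x <= y -> I x <= I y.
Proof.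
move=> x0 xy; have /andP[+ _] := integral0_gauss_increment x0 xy.
rewrite -subr_ge0; apply: le_trans.
by rewrite mulr_ge0 ?subr_ge0 ?gauss_fun_ge0.
Qed.

(** The limit of the square is known, and [I] is nonnegative. *)
Lemma cvg_integral0_gauss : I x @[x --> +oo] --> Num.sqrt pi / 2.
Proof.
have -> : Num.sqrt pi / 2 = Num.sqrt (pi / 4) :> R.
  rewrite sqrtrM ?pi_ge0 // sqrtrV //; congr (_ / _).
  by rewrite (_ : 4 = 2 ^+ 2) ?sqrtr_sqr ?ger0_norm // expr2 -natrM.
have -> : I = (fun x => Num.sqrt (I x ^+ 2)).
  by apply/funext => r; rewrite sqrtr_sqr ger0_norm // gauss_integral_proof.integral0_gauss_ge0.
apply: continuous_cvg; first exact: sqrt_continuous.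
exact: gauss_integral_proof.cvg_integral0_gauss_sqr.
Qed.

Lemma integral0_gauss_le_lim x : 0 <= x -> I x <= Num.sqrt pi / 2.
Proof.
move=> x0; have cI := cvg_integral0_gauss; rewrite -(cvg_lim _ cI) //.
apply: limr_ge; first by apply/cvg_ex; exists (Num.sqrt pi / 2).
near=> y; apply: integral0_gauss_homo => //; near: y; exact: nbhs_pinfty_ge.
Unshelve. all: end_near. Qed.

Lemma gauss_sum_le h M : 0 <= h ->
  h * (\sum_(1 <= m < M.+1) gauss_fun (m%:R * h)) <= Num.sqrt pi / 2.
Proof.
move=> h0; apply: (@le_trans _ _ (I (M%:R * h))); last first.
  by apply: integral0_gauss_le_lim; rewrite mulr_ge0.
elim: M => [|M IH]; first by rewrite big_geq // mulr0 mul0r integral0_gauss0.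
rewrite big_nat_recr //= mulrDr -lerBrDl.
apply: le_trans (lerB (lexx _) IH).
have MM : M%:R * h <= M.+1%:R * h by rewrite ler_wpM2r // ler_nat.
have /andP[+ _] := integral0_gauss_increment (mulr_ge0 (ler0n _ _) h0) MM.
by rewrite -mulrBl -natrB // subSnn mul1r.
Qed.

(** Left-endpoint rectangles lie above the decreasing Gauss function. The sum starts at 2 like the
    cycle sum, and the missing part [I (2 * h)] is at most [2 * h]. *)
Lemma gauss_sum_ge h M : 0 <= h ->
  I (M.+1%:R * h) - 2 * h <= h * (\sum_(2 <= m < M.+1) gauss_fun (m%:R * h)).
Proof.
move=> h0; case: M => [|M].
  rewrite big_geq // mulr0 mul1r; have := integral0_gauss_le h0; lra.
elim: M => [|M IH].
  rewrite big_geq // mulr0; have := @integral0_gauss_le (2 * h) ltac:(lra); lra.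
rewrite big_nat_recr //= mulrDr.
apply: le_trans (lerD IH (lexx _)).
have MM : M.+2%:R * h <= M.+3%:R * h by rewrite ler_wpM2r // ler_nat.
have /andP[_] := integral0_gauss_increment (mulr_ge0 (ler0n _ _) h0) MM.
rewrite -mulrBl -natrB // subSnn mul1r; lra.
Qed.

End GaussSum.

(** * Exponential bounds for falling factorials *)

Section FallingFactorial.
Variable R : realType.

Lemma ffact_ratioS (n r : nat) :
  (n ^_ r.+1)%:R / n%:R ^+ r.+1 = (n ^_ r)%:R / n%:R ^+ r * ((n - r)%:R / n%:R) :> R.
Proof. by rewrite ffactnSr natrM exprSr invfM mulrACA. Qed.

(** The ratio is the product of [1 - k / n] over [k < r], and [1 - k / n <= expR (- k / n)]. *)
Lemma ffact_ratio_le (n r : nat) : (0 < n)%N ->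
  (n ^_ r)%:R / n%:R ^+ r <= expR (- (r%:R * (r%:R - 1)) / (2 * n%:R)) :> R.
Proof.
move=> n0; have n0' : 0 < n%:R :> R by rewrite ltr0n.
elim: r => [|r IH]; first by rewrite ffactn0 expr0 divr1 mul0r oppr0 mul0r expR0.
rewrite ffact_ratioS.
have -> : - (r.+1%:R * (r.+1%:R - 1)) / (2 * n%:R) =
    - (r%:R * (r%:R - 1)) / (2 * n%:R) - r%:R / n%:R :> R.
  by rewrite -natr1; field; rewrite gt_eqF.
rewrite expRD; apply: ler_pM => //.
have [rn|/ltnW nr] := leqP r n; last first.
  by move: nr; rewrite -subn_eq0 => /eqP ->; rewrite mul0r expR_ge0.
rewrite natrB // mulrBl divff ?gt_eqF //; exact: expR_ge1Dx.
Qed.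

(** Invert [1 / (1 - x) = 1 + x / (1 - x) <= 1 + x / (1 - e) <= expR (x / (1 - e))]. *)
Lemma expR_le_1Bx (e x : R) : 0 <= x -> x <= e -> e < 1 -> expR (- (x / (1 - e))) <= 1 - x.
Proof.
move=> x0 xe e1; have x1 : 0 < 1 - x by lra.
rewrite expRN -[leRHS]invrK lef_pV2 ?posrE ?expR_gt0 ?invr_gt0 //.
apply: le_trans (expR_ge1Dx _).
have -> : (1 - x)^-1 = 1 + x / (1 - x) by field; lra.
by rewrite lerD2l ler_wpM2l // lef_pV2 ?posrE; lra.
Qed.

Lemma ffact_ratio_ge (n r : nat) (e : R) : (0 < n)%N -> e < 1 -> r%:R <= e * n%:R ->
  expR (- r%:R ^+ 2 / (2 * n%:R * (1 - e))) <= (n ^_ r)%:R / n%:R ^+ r :> R.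
Proof.
move=> n0 e1 re; have n0' : 0 < n%:R :> R by rewrite ltr0n.
(* The induction runs with [r * (r - 1)], the sum of the exponents of the factors; [r ^ 2] is the
   weakening that fits the Gauss function. *)
apply: (@le_trans _ _ (expR (- (r%:R * (r%:R - 1)) / (2 * n%:R * (1 - e))))).
  rewrite ler_expR ler_wpM2r ?invr_ge0 ?mulr_ge0 //; first lra.
  by rewrite lerN2 expr2 ler_wpM2l //; lra.
elim: r re => [|r IH] re; first by rewrite ffactn0 expr0 divr1 mul0r oppr0 mul0r expR0.
have re' : r%:R <= e * n%:R by apply: le_trans re; rewrite ler_nat.
rewrite ffact_ratioS.
have -> : - (r.+1%:R * (r.+1%:R - 1)) / (2 * n%:R * (1 - e)) =
    - (r%:R * (r%:R - 1)) / (2 * n%:R * (1 - e)) - (r%:R / n%:R) / (1 - e) :> R.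
  by rewrite -natr1; field; rewrite gt_eqF //=; lra.
rewrite expRD; apply: ler_pM; rewrite ?expR_ge0 ?IH //.
have rn : (r <= n)%N.
  by rewrite -(ler_nat R) (le_trans re') // ler_piMl // ltW.
rewrite natrB // mulrBl divff ?gt_eqF //; apply: expR_le_1Bx => //.
by rewrite ler_pdivrMr.
Qed.

End FallingFactorial.

(** * Squeezing the cycle sum between Riemann sums *)

Section CycleSum.
Variable R : realType.
Local Notation I := (@gauss_integral_proof.integral0_gauss R).

Definition cycle_sum (i j : nat) : R :=
  \sum_(2 <= r < (minn i j).+1)
    ((i ^_ r)%:R * (j ^_ r)%:R) / (i%:R ^+ r * j%:R ^+ r) * (i%:R + j%:R - r%:R).

Definition mesh (i j : nat) : R := Num.sqrt ((i%:R + j%:R) / (2 * i%:R * j%:R)).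

Variables i j : nat.
Hypotheses (i0 : (0 < i)%N) (j0 : (0 < j)%N).

Let i0' : 0 < i%:R :> R. Proof. by rewrite ltr0n. Qed.
Let j0' : 0 < j%:R :> R. Proof. by rewrite ltr0n. Qed.

Lemma sqr_mesh : mesh i j ^+ 2 = (i%:R + j%:R) / (2 * i%:R * j%:R).
Proof. by rewrite sqr_sqrtr // divr_ge0 ?addr_ge0 ?mulr_ge0. Qed.

Lemma mesh_gt0 : 0 < mesh i j.
Proof. by rewrite sqrtr_gt0 divr_gt0 ?addr_gt0 ?mulr_gt0. Qed.

Lemma expR_ratio_mesh (x d : R) : 0 < d ->
  expR (- x ^+ 2 / (2 * i%:R * d)) * expR (- x ^+ 2 / (2 * j%:R * d)) =
  gauss_fun (x * (mesh i j / Num.sqrt d)).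
Proof.
move=> d0; rewrite -expRD /gauss_fun; congr expR.
rewrite exprMn expr_div_n sqr_mesh sqr_sqrtr ?(ltW d0) //.
by field; rewrite !gt_eqF.
Qed.

(** By [r * (r - 1) >= (r - 1) ^ 2] the term of index [r] is controlled by the Gauss function at
    [(r - 1) * mesh i j], so the index is shifted to start at 1. *)
Lemma cycle_sum_le : mesh i j * cycle_sum i j <= (i%:R + j%:R) * (Num.sqrt pi / 2).
Proof.
have ij0 : 0 <= i%:R + j%:R :> R by rewrite addr_ge0.
apply: le_trans (ler_wpM2l ij0 (gauss_sum_le (minn i j).-1 (ltW mesh_gt0))).
rewrite mulrCA ler_wpM2l ?(ltW mesh_gt0) // mulr_sumr prednK; last by rewrite leq_min i0.
rewrite /cycle_sum big_add1 /=; apply: ler_sum_nat => r /andP[r1 rm].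
have [ri rj] : (r.+1 <= i)%N /\ (r.+1 <= j)%N by lia.
rewrite mulrC; apply: ler_pM.
- by rewrite subr_ge0 -natrD ler_nat; lia.
- by rewrite divr_ge0 ?mulr_ge0 ?exprn_ge0.
- by rewrite gerBl.
have -> : mesh i j = mesh i j / Num.sqrt 1 by rewrite sqrtr1 divr1.
rewrite -expR_ratio_mesh // invfM mulrACA.
have aux (n : nat) : (0 < n)%N -> (n ^_ r.+1)%:R / n%:R ^+ r.+1
    <= expR (- r%:R ^+ 2 / (2 * n%:R * 1)) :> R.
  move=> n0; apply: le_trans (ffact_ratio_le _ _ n0) _.
  rewrite ler_expR mulr1 ler_wpM2r ?invr_ge0 ?mulr_ge0 // lerN2 expr2.
  by rewrite ler_pM // -natr1; lra.
by apply: ler_pM; rewrite ?aux ?divr_ge0 ?exprn_ge0.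
Qed.

(** Only the terms with [r <= e * minn i j] are kept. There [i + j - r >= (1 - e) * (i + j)], and
    the ratios dominate the Gauss function with step [mesh i j / Num.sqrt (1 - e)], a rescaling that
    costs the factor [Num.sqrt (1 - e)]. *)
Lemma cycle_sum_ge (e : R) : 0 < e -> e < 1 ->
  (i%:R + j%:R) * ((1 - e) * Num.sqrt (1 - e)) *
    (I (e * Num.sqrt ((minn i j)%:R / 2)) - 2 * (mesh i j / Num.sqrt (1 - e)))
  <= mesh i j * cycle_sum i j.
Proof.
move=> e0 e1; set m := minn i j; set s := Num.sqrt (1 - e).
have d0 : 0 < 1 - e by lra.
have s0 : 0 < s by rewrite sqrtr_gt0.
have m0 : (0 < m)%N by rewrite leq_min i0.
have m0' : 0 < m%:R :> R by rewrite ltr0n.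
set h' := mesh i j / s; have h0 := mesh_gt0.
have h'0 : 0 < h' by rewrite divr_gt0.
have em0 : 0 <= e * m%:R by rewrite mulr_ge0 // ltW.
set M := Num.truncn (e * m%:R); have /andP[Me eM] := truncn_itv em0.
rewrite -/M in Me eM.
have Mm : (M <= m)%N.
  rewrite -(ler_nat R) (le_trans Me) // ler_piMl // ltW //.
(* The cut-off [M.+1 * h'] is at least [e * m * mesh i j >= e * Num.sqrt (m / 2)], as
   [mesh i j ^ 2 >= 1 / (2 * m)]. *)
have step1 : I (e * Num.sqrt (m%:R / 2)) - 2 * h'
    <= h' * (\sum_(2 <= r < M.+1) gauss_fun (r%:R * h')).
  apply: le_trans (gauss_sum_ge _ (ltW h'0)); rewrite lerD2r.
  apply: integral0_gauss_homo; first by rewrite mulr_ge0 ?sqrtr_ge0 // ltW.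
  apply: (@le_trans _ _ (e * m%:R * h')); last by rewrite ler_wpM2r // ltW.
  rewrite -mulrA ler_wpM2l ?(ltW e0) //.
  apply: (@le_trans _ _ (m%:R * mesh i j)); last first.
    rewrite ler_wpM2l ?(ltW m0') // ler_peMr ?(ltW h0) // invf_ge1 //.
    by rewrite -[leRHS](@sqrtr1 R) ler_wsqrtr //; lra.
  rewrite -[X in X * mesh i j](gtr0_norm m0') -sqrtr_sqr /mesh -sqrtrM ?sqr_ge0 //.
  rewrite ler_wsqrtr // expr2 -mulrA ler_wpM2l ?(ltW m0') //.
  have -> : (i%:R + j%:R) / (2 * i%:R * j%:R) = (i%:R^-1 + j%:R^-1) / 2 :> R.
    by field; rewrite !gt_eqF.
  rewrite mulrA -[leLHS]mul1r ler_pM2r ?invr_gt0 //.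
  have [mi|mj] : m = i \/ m = j by lia.
    by rewrite mulrDr mi divff ?gt_eqF // lerDl divr_ge0.
  by rewrite mulrDr mj divff ?gt_eqF // lerDr divr_ge0.
have pre0 : 0 <= (i%:R + j%:R) * ((1 - e) * s) by rewrite mulr_ge0 ?addr_ge0 // mulr_ge0 // ltW.
apply: le_trans (ler_wpM2l pre0 step1) _.
have -> : (i%:R + j%:R) * ((1 - e) * s) * (h' * \sum_(2 <= r < M.+1) gauss_fun (r%:R * h'))
   = mesh i j * \sum_(2 <= r < M.+1) gauss_fun (r%:R * h') * ((i%:R + j%:R) * (1 - e)).
  rewrite -mulr_suml /h'; field; rewrite gt_eqF //.
rewrite ler_wpM2l ?(ltW h0) // /cycle_sum.
rewrite (big_nat_widen 2 M.+1 m.+1) // big_mkcond /=; apply: ler_sum_nat => r /andP[r2 rm].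
have /andP[ri rj] : (r <= i)%N && (r <= j)%N by rewrite -leq_min -ltnS.
have tail : 0 <= i%:R + j%:R - r%:R :> R by rewrite subr_ge0 -natrD ler_nat (leq_trans ri) ?leq_addr.
case: ifP => rM; last first.
  by rewrite !mulr_ge0 ?invr_ge0 ?mulr_ge0 ?exprn_ge0.
have rem : r%:R <= e * m%:R by apply: le_trans Me; rewrite ler_nat -ltnS.
have rei : r%:R <= e * i%:R.
  by apply: (le_trans rem); rewrite ler_wpM2l ?(ltW e0) // ler_nat geq_minl.
have rej : r%:R <= e * j%:R.
  by apply: (le_trans rem); rewrite ler_wpM2l ?(ltW e0) // ler_nat geq_minr.
apply: ler_pM.
- exact: gauss_fun_ge0.
- by rewrite mulr_ge0 ?(ltW d0) ?addr_ge0.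
- rewrite -expR_ratio_mesh // [in leRHS]invfM [leRHS]mulrACA.
  by apply: ler_pM; rewrite ?expR_ge0 ?ffact_ratio_ge.
have := mulr_ge0 (ltW e0) (ltW j0'); lra.
Qed.

Lemma mesh_le_min : mesh i j <= Num.sqrt (minn i j)%:R^-1.
Proof.
rewrite ler_wsqrtr //.
have -> : (i%:R + j%:R) / (2 * i%:R * j%:R) = (i%:R^-1 + j%:R^-1) / 2 :> R.
  by field; rewrite !gt_eqF.
have m0 : (0 < minn i j)%N by rewrite leq_min i0.
have a : i%:R^-1 <= (minn i j)%:R^-1 :> R by rewrite lef_pV2 ?posrE ?ltr0n // ler_nat geq_minl.
have b : j%:R^-1 <= (minn i j)%:R^-1 :> R by rewrite lef_pV2 ?posrE ?ltr0n // ler_nat geq_minr.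
lra.
Qed.

End CycleSum.

(** * The asymptotic formula *)

Section Asymptotics.
Variable R : realType.
Local Notation I := (@gauss_integral_proof.integral0_gauss R).

Lemma cycle_sum_asymp_ge (eta : R) : 0 < eta ->
  exists K : nat, forall i j : nat, (0 < i)%N -> (0 < j)%N -> (K <= minn i j)%N ->
    (1 - eta) * ((i%:R + j%:R) * (Num.sqrt pi / 2)) <= mesh R i j * cycle_sum R i j.
Proof.
move=> eta0; set c : R := Num.sqrt pi / 2.
have c0 : 0 < c by rewrite divr_gt0 // sqrtr_gt0 pi_gt0.
(* A factor [1 - e] is lost three times, to [i + j - r], to the rescaled step and to the integral,
   and [(1 - e) ^ 3 >= 1 - 3 * e]. *)
have [e [e0 e1 e3]] : exists e : R, [/\ 0 < e, e < 1 & 3 * e <= eta].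
  have [h|h] := leP eta 1; first by exists (eta / 4); split; lra.
  by exists (1 / 4); split; lra.
set s := Num.sqrt (1 - e); have d0 : 0 < 1 - e by lra.
have s0 : 0 < s by rewrite sqrtr_gt0.
have s1 : 1 - e <= s.
  have ss : s ^+ 2 = 1 - e by rewrite sqr_sqrtr // ltW.
  have : s <= 1 by rewrite -[leRHS](@sqrtr1 R) ler_wsqrtr //; lra.
  by move=> s1; rewrite -ss expr2 ler_piMl // ltW.
have ce : c * (1 - e / 2) < c by rewrite -[ltRHS]mulr1 ltr_pM2l //; lra.
have [A [_ HA]] := cvgr_gt _ (@cvg_integral0_gauss R) _ ce.
pose w : R := Num.sqrt 2; have w0 : 0 < w by rewrite sqrtr_gt0.
(* The first summand makes [e * Num.sqrt (m / 2)] exceed [A], where the integral is within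
   [c * e / 2] of its limit; the second makes the error [2 * (mesh R i j / s)] at most
   [c * e / 2]. *)
pose B := w * (`|A| + 1) / e + 4 / (s * e * c).
have A0 : 0 < `|A| + 1 by have := normr_ge0 A; lra.
have sec0 : 0 < s * e * c := mulr_gt0 (mulr_gt0 s0 e0) c0.
have B1 : 0 < w * (`|A| + 1) / e := divr_gt0 (mulr_gt0 w0 A0) e0.
have B2 : 0 < 4 / (s * e * c) by rewrite divr_gt0.
have B0 : 0 < B by rewrite addr_gt0.
exists (Num.truncn (B ^+ 2)).+1 => i j i0 j0 mK; set m := minn i j in mK *.
have mB : B < Num.sqrt m%:R.
  have BB : B ^+ 2 < m%:R.
    have /andP[_ /lt_le_trans->//] := truncn_itv (sqr_ge0 B).
    by rewrite ler_nat.
  by rewrite -(gtr0_norm B0) -sqrtr_sqr ltr_sqrt // (le_lt_trans (sqr_ge0 B)).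
have q0 : 0 < Num.sqrt m%:R :> R by apply: lt_trans mB.
have m0 : (0 < m)%N by rewrite leq_min i0.
have IA : c * (1 - e / 2) < I (e * Num.sqrt (m%:R / 2)).
  apply: HA; apply: le_lt_trans (ler_norm A) _.
  rewrite sqrtrM // sqrtrV // -/w mulrA ltr_pdivlMr //.
  have : w * (`|A| + 1) / e < Num.sqrt m%:R.
    by apply: le_lt_trans mB; rewrite lerDl ltW.
  by rewrite ltr_pdivrMr // => hA; lra.
have meshle : 2 * (mesh R i j / s) <= c * (e / 2).
  have : 4 / (s * e * c) < Num.sqrt m%:R.
    by apply: le_lt_trans mB; rewrite lerDr ltW.
  rewrite ltr_pdivrMr // => hq.
  have := mesh_le_min R i0 j0; rewrite -/m sqrtrV // => mq.
  rewrite mulrA ler_pdivrMr //.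
  have : 2 * mesh R i j <= 2 / Num.sqrt m%:R by rewrite ler_wpM2l.
  move/le_trans; apply; rewrite ler_pdivrMr //.
  nra.
apply: le_trans (cycle_sum_ge i0 j0 e0 e1); rewrite -/s -/m.
rewrite mulrCA -mulrA ler_wpM2l ?addr_ge0 //.
apply: (@le_trans _ _ ((1 - e) * s * (c * (1 - e)))); last first.
  by rewrite ler_wpM2l ?mulr_ge0 ?(ltW s0) ?(ltW d0) //; lra.
apply: (@le_trans _ _ ((1 - e) * (1 - e) * (c * (1 - e)))); last first.
  by rewrite ler_wpM2r ?mulr_ge0 ?(ltW c0) ?(ltW d0) // ler_wpM2l // ltW.
have : 0 <= e ^+ 2 * (3 - e) by rewrite mulr_ge0 ?sqr_ge0 //; lra.
move=> h; rewrite [leRHS](_ : _ = (1 - 3 * e + e ^+ 2 * (3 - e)) * c); last by ring.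
by rewrite ler_wpM2r ?(ltW c0) //; lra.
Qed.

Lemma powRB_half (x y : nat) : (0 < x)%N -> (0 < y)%N ->
  (x%:R : R) `^ (y%:R - 2^-1) = x%:R ^+ (y - 1) * Num.sqrt x%:R.
Proof.
move=> x0 y0; have x0' : x%:R != 0 :> R by rewrite pnatr_eq0 -lt0n.
have -> : y%:R - 2^-1 = (y - 1)%:R + 2^-1 :> R by rewrite natrB //; lra.
rewrite powRD; last by rewrite x0' implybT.
by rewrite powR_mulrn // powR12_sqrt.
Qed.

(** The factor [mesh] supplies the other half power of [i + j] and removes the half powers of [i]
    and [j]: what remains is the prefactor of the exact formula times the leading term of
    [mesh * cycle_sum]. *)
Lemma mesh_target (i j : nat) : (0 < i)%N -> (0 < j)%N ->
  Num.sqrt (pi / 8) * Num.sqrt (i%:R + j%:R) * i%:R `^ (j%:R - 2^-1) *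
    j%:R `^ (i%:R - 2^-1) * mesh R i j =
  2^-1 * i%:R ^+ (j - 1) * j%:R ^+ (i - 1) * ((i%:R + j%:R) * (Num.sqrt pi / 2)) :> R.
Proof.
move=> i0 j0; rewrite !powRB_half //.
have -> : Num.sqrt (pi / 8) = Num.sqrt pi / (2 * Num.sqrt 2) :> R.
  rewrite sqrtrM ?pi_ge0 // sqrtrV //; congr (_ / _).
  have -> : 8 = 2 ^+ 2 * 2 :> R by ring.
  by rewrite sqrtrM ?sqr_ge0 // sqrtr_sqr ger0_norm.
have -> : mesh R i j = Num.sqrt (i%:R + j%:R) / (Num.sqrt 2 * Num.sqrt i%:R * Num.sqrt j%:R).
  by rewrite /mesh sqrtrM ?addr_ge0 // sqrtrV ?mulr_ge0 // !sqrtrM ?mulr_ge0.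
have i0' : Num.sqrt i%:R != 0 :> R by rewrite gt_eqF // sqrtr_gt0 ltr0n.
have j0' : Num.sqrt j%:R != 0 :> R by rewrite gt_eqF // sqrtr_gt0 ltr0n.
have w0 : Num.sqrt 2 != 0 :> R by rewrite gt_eqF // sqrtr_gt0.
have w2 : Num.sqrt 2 ^+ 2 = 2 :> R by rewrite sqr_sqrtr.
have q2 : Num.sqrt (i%:R + j%:R) ^+ 2 = i%:R + j%:R :> R by rewrite sqr_sqrtr ?addr_ge0.
set q := Num.sqrt (i%:R + j%:R) in q2 *; rewrite -q2.
set w := Num.sqrt 2 in w0 w2 *.
set X := _ ^+ (j - 1); set Y := _ ^+ (i - 1).
transitivity (X * Y * Num.sqrt pi * q ^+ 2 / (2 * w ^+ 2)).
  by field; rewrite i0' j0' w0.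
by rewrite w2; field.
Qed.

End Asymptotics.

Theorem theorem3p3 (R : realType) :
  (forall i j : nat, (0 < i)%N -> (0 < j)%N ->
     (bip_count i j 0)%:R =
       2^-1 * i%:R ^+ (j - 1) * j%:R ^+ (i - 1) *
       \sum_(2 <= r < (minn i j).+1)
          ((i ^_ r)%:R * (j ^_ r)%:R) / (i%:R ^+ r * j%:R ^+ r) *
          (i%:R + j%:R - r%:R) :> R)
  /\
  (forall i j : nat -> nat,
     (forall n, (0 < i n)%N) -> (forall n, (0 < j n)%N) ->
     i @ \oo --> \oo -> j @ \oo --> \oo ->
     (forall n, 2^-1 <= ((i n)%:R / (j n)%:R : R) <= 2) ->
     (fun n => (bip_count (i n) (j n) 0)%:R : R) ~_\oo
     (fun n => Num.sqrt (pi / 8) * Num.sqrt ((i n)%:R + (j n)%:R) *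
               (i n)%:R `^ ((j n)%:R - 2^-1) *
               (j n)%:R `^ ((i n)%:R - 2^-1) : R)).
Proof.
split=> [i j i0 j0|i j i0 j0 ioo joo _]; first exact: bip_count0E.
apply/eqaddoP => eta eta0; have [K HK] := cycle_sum_asymp_ge eta0.
have Ki : \forall n \near \oo, (K <= i n)%N by move/cvgnyPge : ioo; exact.
have Kj : \forall n \near \oo, (K <= j n)%N by move/cvgnyPge : joo; exact.
near=> n.
have Kin : (K <= i n)%N by near: n.
have Kjn : (K <= j n)%N by near: n.
have lo := HK _ _ (i0 n) (j0 n) ltac:(by rewrite leq_min Kin).
have up := cycle_sum_le R (i0 n) (j0 n).
have h0 := mesh_gt0 R (i0 n) (j0 n).
have target := mesh_target R (i0 n) (j0 n).
rewrite /= !fctE.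
set t := (X in X * mesh R _ _ = _) in target *.
rewrite bip_count0E // -/(cycle_sum R (i n) (j n)).
set P := (X in X * cycle_sum R _ _); rewrite -/P in target.
have P0 : 0 <= P by rewrite !mulr_ge0 ?exprn_ge0.
have t0 : 0 <= t by rewrite !mulr_ge0 ?sqrtr_ge0 ?powR_ge0.
(* Multiplying by [mesh] and cancelling [P] reduces the claim to the bounds [lo] and [up]. *)
rewrite (ger0_norm t0) -(ler_pM2r h0) -{1}(gtr0_norm h0) -normrM mulrBl.
rewrite -[eta * t * _]mulrA target -[P * _ * _]mulrA [cycle_sum _ _ _ * _]mulrC -mulrBr.
rewrite normrM (ger0_norm P0) [leRHS]mulrCA ler_wpM2l // ler_norml.
lra.
Unshelve. all: end_near. Qed.
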